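(* For every finite group $G$, $$P_4(G)=\frac{1}{|G|^3}\sum_{[g]\subseteq G}\ \sum_{[h]\subseteq C_G(g)}k(C_G(g,h)),$$ equivalently $$|G|^3P_4(G)=\kappa_3(G)=\sum_{[g]\subseteq G}\ \sum_{[h]\subseteq C_G(g)}k(C_G(g,h)),$$ where the outer sum runs over the conjugacy classes $[g]$ of $G$ and, for each such class (with representative $g$), the inner sum runs over the $C_G(g)$-conjugacy classes $[h]$ in $C_G(g)$; equivalently, the total sum is over $G$-orbits (under simultaneous conjugation) of commuting pairs $(g,h)$.
   Context: For a finite group $G$ and $r\ge 1$, $\mathrm{Comm}_r(G):=\{(x_1,\dots,x_r)\in G^r : x_ix_j=x_jx_i\ \text{for all } i,j\}$ and $P_r(G):=|\mathrm{Comm}_r(G)|/|G|^r$. $\kappa_r(G)$ is the number of orbits of $G$ acting on $\mathrm{Comm}_r(G)$ by simultaneous (diagonal) conjugation. $k(H)$ is the number of conjugacy classes of a finite group $H$; $C_G(g)$ is the centralizer of $g$ and $C_G(g,h)=C_G(g)\cap C_G(h)$. *)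

(* Defs.v *)
From mathcomp Require Import all_boot all_order all_algebra all_fingroup.

Set Implicit Arguments.
Unset Strict Implicit.
Unset Printing Implicit Defensive.

Import GroupScope GRing.Theory.

Section CommutingTuples.

Variable gT : finGroupType.
Implicit Types (G H : {group gT}) (r : nat).

Definition Comm r G : {set r.-tuple gT} :=
  [set t : r.-tuple gT | [forall i, tnth t i \in G]
                         && [forall i, forall j,
                               tnth t i * tnth t j == tnth t j * tnth t i]].

Definition commuting_prob r G : rat :=
  (#|Comm r G|%:R / #|G|%:R ^+ r)%R.

Definition diag_conj r (t : r.-tuple gT) (x : gT) : r.-tuple gT :=
  [tuple tnth t i ^ x | i < r].

Lemma diag_conj1 r : @diag_conj r ^~ 1 =1 id.
Proof. by move=> t; apply: eq_from_tnth => i; rewrite tnth_mktuple conjg1. Qed.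

Lemma diag_conjM r (t : r.-tuple gT) (x y : gT) :
  diag_conj t (x * y) = diag_conj (diag_conj t x) y.
Proof. by apply: eq_from_tnth => i; rewrite !tnth_mktuple conjgM. Qed.

Canonical diag_conj_action r := TotalAction (@diag_conj1 r) (@diag_conjM r).

Definition comm_orbits r G : {set {set r.-tuple gT}} :=
  orbit (diag_conj_action r) G @: Comm r G.

Definition kappa r G : nat := #|comm_orbits r G|.

Definition class_number H : nat := #|classes H|.

Definition cent2 G (g h : gT) : {group gT} := ('C_G[g] :&: 'C_G[h])%G.

(* Conjugacy classes are sets, so a sum over them depends a priori on a choice
   of representatives: [rep C] is the representative of the G-class C, and
   [rep' g D] that of the 'C_G[g]-class D. *)
Definition class_sum G (rep : {set gT} -> gT) (rep' : gT -> {set gT} -> gT) :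
    nat :=
  \sum_(C in classes G) \sum_(D in classes 'C_G[rep C])
    class_number (cent2 G (rep C) (rep' (rep C) D)).

Definition pair_orbit_sum G (rep : {set 2.-tuple gT} -> 2.-tuple gT) : nat :=
  \sum_(O in comm_orbits 2 G)
    class_number (cent2 G (tnth (rep O) ord0) (tnth (rep O) ord_max)).

End CommutingTuples.

(* Main.v *)
Require Import Defs.
From mathcomp Require Import all_boot all_order all_algebra all_fingroup.

(** Each of the three integers in the theorem (the number [kappa 3 G] of orbits
of commuting triples, the iterated class sum, and the sum over orbits of
commuting pairs), multiplied by [#|G|], counts the commuting quadruples of [G].
There are two ingredients.

The first is orbit-stabiliser with weights ([sum_over_orbits]): an orbit [O]
of [G] with stabiliser [K] at a chosen point has [#|G| / #|K|] elements, so
[#|G| * F O] is the sum over [O] of the constant [#|K| * F O]. If that constant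
is the value on [O] of an invariant function [N], then [#|G|] times the sum of
the [F O] is the sum of [N] over all the points, and the representatives
have disappeared.

The second is that commuting tuples can be cut anywhere ([card_CommD]): a
commuting [(r + s)]-tuple is a commuting [r]-tuple [t] followed by a commuting
[s]-tuple of the centraliser of [t], which is the stabiliser of [t] for
diagonal conjugation.

Cutting 4 as 3 + 1 gives [kappa 3 G], where [F = 1] and [N t] is the order of
the centraliser of [t]. For the other two sums, [#|H| * k(H)] is the number of
commuting pairs of [H] ([card_classes_Comm]), so cutting 4 as 2 + 2 gives the
sum over orbits of pairs. In the iterated sum, the first ingredient applied
inside ['C_G[g]] turns the inner sum into the number of commuting triples of
['C_G[g]], and applied in [G] it turns the outer sum into the number of
commuting quadruples. *)

Set Implicit Arguments.
Unset Strict Implicit.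
Unset Printing Implicit Defensive.

Import GroupScope GRing.Theory.

(** * Weighted orbit counting *)

(** The hypothesis on [F] mentions [rep O] only, because [F O] may itself
depend on choices made at that representative, as in the iterated class sum. *)
Lemma sum_over_orbits (aT : finGroupType) (T : finType)
    (to : {action aT &-> T}) (G : {group aT}) (S : {set T})
    (rep : {set T} -> T) (F : {set T} -> nat) (N : T -> nat) :
    [acts G, on S | to] ->
    {in orbit to G @: S, forall O, rep O \in O} ->
    {in S & G, forall x a, N (to x a) = N x} ->
    {in orbit to G @: S, forall O, #|'C_G[rep O | to]| * F O = N (rep O)}%N ->
  (#|G| * \sum_(O in orbit to G @: S) F O = \sum_(x in S) N x)%N.
Proof.
move=> actS repO NJ FN.
rewrite (partition_big_imset (orbit to G)) big_distrr /=.
apply: eq_bigr => O SO; have /imsetP[x Sx defO] := SO.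
have := repO O SO; rewrite {2}defO => xy.
set y := rep O in xy *.
have Oy : O = orbit to G y by rewrite defO; apply/esym/orbit_eqP/xy.
have Sy : y \in S by apply: (subsetP _ _ xy); rewrite acts_sub_orbit.
rewrite (eq_bigl (fun z => z \in orbit to G y)) => [|z]; last first.
  rewrite {1}Oy; apply/andP/idP => [[_ /eqP <-]|yz]; first exact: orbit_refl.
  split; last exact/eqP/orbit_eqP.
  by apply: (subsetP _ _ yz); rewrite acts_sub_orbit.
rewrite (eq_bigr (fun=> N y)) => [|z /orbitP[a Ga <-]]; last exact: NJ.
by rewrite sum_nat_const -FN // mulnA card_orbit_stab.
Qed.

(** * Commuting tuples and their centralisers *)

Section CommutingTuples.

Variable gT : finGroupType.
Implicit Types (G H : {group gT}) (r s : nat) (g h x : gT).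

Lemma CommP r G (t : r.-tuple gT) :
  reflect ((forall i, tnth t i \in G) /\
           (forall i j, commute (tnth t i) (tnth t j)))
          (t \in Comm r G).
Proof.
rewrite inE; apply: (iffP andP) => [[/forallP Gt /forallP cc] | [Gt cc]].
  by split=> // i j; apply/eqP; have /forallP := cc i; apply.
by split; apply/forallP => // i; apply/forallP => j; apply/eqP/cc.
Qed.

(** Fixing every entry of [t] by conjugation is commuting with every entry, so
the stabilisers of diagonal conjugation are the centralisers of tuples. *)
Lemma stab_diagP r (t : r.-tuple gT) x :
  reflect (forall i, commute x (tnth t i)) (x \in 'C[t | diag_conj_action gT r]).
Proof.
apply: (iffP astab1P) => [tx i | cx].
  have /(congr1 (fun u => tnth u i)) := tx; rewrite tnth_mktuple => /conjg_fixP.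
  by move/commgP/commute_sym.
apply: eq_from_tnth => i; rewrite tnth_mktuple.
by apply/conjg_fixP/commgP/commute_sym.
Qed.

Lemma stab_diag_cons r g (t : r.-tuple gT) :
  'C[[tuple of g :: t] | diag_conj_action gT r.+1]
    = 'C[g] :&: 'C[t | diag_conj_action gT r].
Proof.
apply/setP=> x; apply/stab_diagP/setIP => [cx | [/cent1P cgx /stab_diagP cx] i].
  split; first by apply/cent1P; have := cx ord0; rewrite tnth0.
  by apply/stab_diagP => i; have := cx (lift ord0 i); rewrite tnthS.
by case: (unliftP ord0 i) => [j|] ->; rewrite ?tnthS ?tnth0.
Qed.

Lemma stab_diag_nil (t : 0.-tuple gT) : 'C[t | diag_conj_action gT 0] = setT.
Proof. by apply/setP=> x; rewrite [in RHS]inE; apply/stab_diagP => -[]. Qed.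

Lemma mem_Comm_cons r G g (t : r.-tuple gT) :
  ([tuple of g :: t] \in Comm r.+1 G) = (g \in G) && (t \in Comm r 'C_G[g]).
Proof.
apply/CommP/andP => [[Gt cc] | [Gg /CommP[Gt cc]]].
  split; first by have := Gt ord0; rewrite tnth0.
  apply/CommP; split=> [i | i j].
    have := Gt (lift ord0 i); have := cc ord0 (lift ord0 i).
    by rewrite tnthS tnth0 => /commute_sym/cent1P Ct Gti; apply/setIP.
  by have := cc (lift ord0 i) (lift ord0 j); rewrite !tnthS.
have Ct i : commute g (tnth t i) by apply/commute_sym/cent1P; case/setIP: (Gt i).
split=> [i | i j].
  by case: (unliftP ord0 i) => [k|] ->; rewrite ?tnthS ?tnth0 //; case/setIP: (Gt k).
case: (unliftP ord0 i) => [k|] ->; case: (unliftP ord0 j) => [l|] ->;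
  rewrite ?tnthS ?tnth0 //.
exact/commute_sym/Ct.
Qed.

Lemma sum_Comm_cons r G (f : r.+1.-tuple gT -> nat) :
  (\sum_(t in Comm r.+1 G) f t
    = \sum_(g in G) \sum_(t in Comm r 'C_G[g]) f [tuple of g :: t])%N.
Proof.
rewrite pair_big_dep /=.
rewrite (reindex (fun p : gT * r.-tuple gT => [tuple of p.1 :: p.2])).
  by apply: eq_bigl => -[g t]; rewrite mem_Comm_cons.
exists (fun t => (thead t, [tuple of behead t])) => [[g t]|t] _ /=.
  by congr pair; apply: val_inj.
by rewrite -tuple_eta.
Qed.

Lemma card_CommS r G : #|Comm r.+1 G| = (\sum_(g in G) #|Comm r 'C_G[g]|)%N.
Proof.
rewrite -sum1_card sum_Comm_cons.
by apply: eq_bigr => g _; rewrite sum1_card.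
Qed.

Lemma Comm0 G : Comm 0 G = [set [tuple]].
Proof.
apply/setP=> t; rewrite [t]tuple0 set11.
by apply/CommP; split=> -[].
Qed.

Lemma card_Comm1 G : #|Comm 1 G| = #|G|.
Proof.
rewrite card_CommS -sum1_card.
by apply: eq_bigr => g _; rewrite Comm0 cards1.
Qed.

Lemma eq_Comm r G H : G :=: H -> Comm r G = Comm r H.
Proof. by move=> /group_inj ->. Qed.

(** The tail commutes with [t] because it lies in the stabiliser of [t]; the
induction moves one entry of [t] at a time into the ambient group, replacing
[G] by ['C_G[g]]. *)
Lemma card_CommD r s G :
  #|Comm (r + s) G|
    = (\sum_(t in Comm r G) #|Comm s 'C_G[t | diag_conj_action gT r]|)%N.
Proof.
elim: r G => [|r IHr] G.
  rewrite Comm0 big_set1; congr #|pred_of_set _|.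
  by apply: eq_Comm; rewrite /= stab_diag_nil setIT.
rewrite addSn card_CommS sum_Comm_cons.
apply: eq_bigr => g _; rewrite IHr; apply: eq_bigr => t _.
congr #|pred_of_set _|; apply: eq_Comm => /=.
have -> := stab_diag_cons g t; exact: esym (setIA _ _ _).
Qed.

(** * Invariance under conjugation *)

Lemma diag_conj_Comm r G (t : r.-tuple gT) x :
  (diag_conj t x \in Comm r (G :^ x)) = (t \in Comm r G).
Proof.
rewrite !inE; congr andb; apply: eq_forallb => i; rewrite ?tnth_mktuple ?memJ_conjg //.
apply: eq_forallb => j; rewrite !tnth_mktuple -!conjMg.
exact: inj_eq (conjg_inj x) _ _.
Qed.

Lemma card_CommJ r G x : #|Comm r (G :^ x)| = #|Comm r G|.
Proof.
rewrite -[RHS](card_imset _ (act_inj (diag_conj_action gT r) x)).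
congr #|pred_of_set _|; apply/setP=> t.
apply/idP/imsetP => [Gt | [u Gu ->]]; last by rewrite /= diag_conj_Comm.
exists (diag_conj t x^-1); last by rewrite /= -diag_conjM mulVg diag_conj1.
by rewrite -(diag_conj_Comm G _ x) -diag_conjM mulVg diag_conj1.
Qed.

Lemma acts_Comm r G : [acts G, on Comm r G | diag_conj_action gT r].
Proof.
apply/actsP=> x Gx t /=.
by rewrite -(diag_conj_Comm G t x) (eq_Comm r (conjGid Gx)).
Qed.

(** With [card_Comm_cent1J], this supplies the invariant functions [N] of
[sum_over_orbits]: moving a point conjugates its stabiliser. *)
Lemma card_Comm_stabJ r s G (t : r.-tuple gT) x : x \in G ->
  #|Comm s 'C_G[diag_conj t x | diag_conj_action gT r]|
    = #|Comm s 'C_G[t | diag_conj_action gT r]|.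
Proof.
move=> Gx; rewrite -(card_CommJ s 'C_G[t | _]%G x).
congr #|pred_of_set _|; apply: eq_Comm => /=.
by rewrite conjIg conjGid // -astab1_act.
Qed.

Lemma card_Comm_cent1J r G g x : x \in G ->
  #|Comm r 'C_G[g ^ x]| = #|Comm r 'C_G[g]|.
Proof.
move=> Gx; rewrite -(card_CommJ r 'C_G[g]%G x).
by congr #|pred_of_set _|; apply: eq_Comm; rewrite /= conjIg conjGid // cent1J.
Qed.

(** * The three sums count commuting quadruples *)

(** Conjugacy classes are the orbits of conjugation, and centralisers of
elements are its stabilisers. *)
Lemma sum_over_classes G (rep : {set gT} -> gT) (F : {set gT} -> nat)
    (N : gT -> nat) :
    {in classes G, forall C, rep C \in C} ->
    {in G &, forall g x, N (g ^ x) = N g} ->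
    {in classes G, forall C, #|'C_G[rep C]| * F C = N (rep C)}%N ->
  (#|G| * \sum_(C in classes G) F C = \sum_(g in G) N g)%N.
Proof.
have -> : classes G = orbit 'J G @: G by [].
move=> repC NJ FN; apply: sum_over_orbits repC NJ _ => [|C GC].
  by rewrite astabsJ normG.
by rewrite -FN // astab1J.
Qed.

Lemma card_classes_Comm G : (#|G| * class_number G)%N = #|Comm 2 G|.
Proof.
rewrite card_CommS /class_number -[#|classes G|]sum1_card.
apply: (@sum_over_classes G repr) => [C /imsetP[g _ ->]|g x _ Gx|C _].
- exact: mem_repr (class_refl _ _).
- exact: card_Comm_cent1J.
- by rewrite muln1 card_Comm1.
Qed.

Lemma card_kappa r G : (#|G| * kappa r G)%N = #|Comm r.+1 G|.
Proof.
rewrite -addn1 card_CommD /kappa -[#|comm_orbits r G|]sum1_card.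
(* [F = 1] ignores the representatives, so any choice will do; the default
   is never taken, as orbits are not empty. *)
pose rep (O : {set r.-tuple gT}) := odflt [tuple of nseq r 1] [pick t : r.-tuple gT in O].
apply: (@sum_over_orbits _ _ (diag_conj_action gT r) G (Comm r G) rep); first exact: acts_Comm.
- move=> _ /imsetP[t _ ->]; rewrite /rep; case: pickP => //= /(_ t).
  by rewrite orbit_refl.
- by move=> t x _ Gx; exact: card_Comm_stabJ.
- by move=> O _; rewrite muln1 card_Comm1.
Qed.

(** The centraliser in ['C_G[g]] of an element [h] is [cent2 G g h], so the
inner sum at [g] counts the commuting triples of ['C_G[g]]. *)
Lemma card_class_sum G (rep : {set gT} -> gT) (rep' : gT -> {set gT} -> gT) :
    {in classes G, forall C, rep C \in C} ->
    {in classes G, forall C,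
      {in classes 'C_G[rep C], forall D, rep' (rep C) D \in D}} ->
  (#|G| * class_sum G rep rep')%N = #|Comm 4 G|.
Proof.
move=> repC repD; rewrite card_CommS.
apply: (@sum_over_classes G rep) => // [g x _ Gx|C GC].
  exact: card_Comm_cent1J.
rewrite card_CommS.
apply: (@sum_over_classes 'C_G[rep C]%G (rep' (rep C))); first exact: repD.
  by move=> h x _ Cx; exact: card_Comm_cent1J.
move=> D _; set g := rep C; set h := rep' g D.
have defC : 'C_('C_G[g])[h] = cent2 G g h.
  by rewrite /= -setIIr setIA.
by rewrite defC card_classes_Comm (@eq_Comm 2 'C_('C_G[g])[h]%G _ defC).
Qed.

(** A pair has stabiliser [cent2 G g h], and a quadruple is a commuting pair
followed by a commuting pair of that stabiliser. *)
Lemma card_pair_orbit_sum G (rep : {set 2.-tuple gT} -> 2.-tuple gT) :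
    {in comm_orbits 2 G, forall O, rep O \in O} ->
  (#|G| * pair_orbit_sum G rep)%N = #|Comm 4 G|.
Proof.
move=> repO; rewrite (card_CommD 2 2).
apply: (@sum_over_orbits _ _ (diag_conj_action gT 2) G (Comm 2 G) rep) => //; first exact: acts_Comm.
  by move=> t x _ Gx; exact: card_Comm_stabJ.
move=> O _; set t := rep O.
have defC : 'C_G[t | diag_conj_action gT 2]
    = cent2 G (tnth t ord0) (tnth t ord_max).
  apply/setP=> x; apply/setIP/setIP => [[Gx /stab_diagP cx] | []].
    by split; apply/setIP; split=> //; apply/cent1P.
  move=> /setIP[Gx /cent1P c0] /setIP[_ /cent1P c1].
  split=> //; apply/stab_diagP => i.
  case: (unliftP ord_max i) => [j|] -> //.
  by have -> : lift ord_max j = ord0 by rewrite [j]ord1; apply: val_inj.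
rewrite defC card_classes_Comm.
by congr #|pred_of_set _|; apply: eq_Comm.
Qed.

End CommutingTuples.

Theorem theorem4p7 (gT : finGroupType) (G : {group gT})
    (rep : {set gT} -> gT) (rep' : gT -> {set gT} -> gT)
    (rep2 : {set 2.-tuple gT} -> 2.-tuple gT)
    (rep_in : forall C : {set gT}, C \in classes G -> rep C \in C)
    (rep'_in : forall C D : {set gT}, C \in classes G ->
       D \in classes ('C_G[rep C])%g -> rep' (rep C) D \in D)
    (rep2_in : forall O : {set 2.-tuple gT},
       O \in comm_orbits 2 G -> rep2 O \in O) :
  [/\ commuting_prob 4 G
        = (1 / #|G|%:R ^+ 3 * (class_sum G rep rep')%:R)%R,
      (#|G|%:R ^+ 3 * commuting_prob 4 G)%R = ((kappa 3 G)%:R)%R,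
      kappa 3 G = class_sum G rep rep'
    & class_sum G rep rep' = pair_orbit_sum G rep2].
Proof.
have G_gt0 := cardG_gt0 G.
have kC := card_kappa 3 G.
have cC := card_class_sum rep_in (fun C GC D => rep'_in C D GC).
have pC := card_pair_orbit_sum rep2_in.
have ck : class_sum G rep rep' = kappa 3 G.
  by apply/eqP; rewrite -(eqn_pmul2l G_gt0) cC kC.
have cp : class_sum G rep rep' = pair_orbit_sum G rep2.
  by apply/eqP; rewrite -(eqn_pmul2l G_gt0) cC pC.
have G_neq0 : (#|G|%:R != 0 :> rat)%R by rewrite Num.Theory.pnatr_eq0 -lt0n.
have P4 : (#|G|%:R ^+ 3 * commuting_prob 4 G)%R = ((kappa 3 G)%:R)%R :> rat.
  rewrite /commuting_prob -kC natrM (exprS _ 3) -mulf_div mulfV // mul1r.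
  by rewrite mulrCA mulfV ?mulr1 // expf_neq0.
split=> //.
by rewrite ck -P4 mul1r mulKf // expf_neq0.
Qed.
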